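(* There exists $n_0$ such that the following holds for every integer $n\ge n_0$. Put $r=\lfloor (n-1)/2\rfloor$. If a simple $n$-vertex $r$-uniform hypergraph $\mathcal H$ contains a Hamiltonian Berge cycle $C$ and an edge $f\in E(\mathcal H)\setminus E(C)$, then the subhypergraph with edge set $E(C)\cup\{f\}$ is Berge-pancyclic, i.e. it contains Berge cycles of every length $2,3,\ldots,n$.
   Context: All hypergraphs are finite and simple: the edge family consists of distinct subsets of the vertex set. A Berge cycle of length $\ell\ge 2$ in a hypergraph is an alternating sequence $x_0h_0x_1h_1\cdots x_{\ell-1}h_{\ell-1}x_0$ in which the vertices $x_0,\dots,x_{\ell-1}$ are distinct, the hyperedges $h_0,\dots,h_{\ell-1}$ are distinct, and $\{x_i,x_{i+1}\}\subseteq h_i$ for every $i$ (indices modulo $\ell$). Thus a Berge cycle of length $2$ consists of two distinct vertices and two distinct hyperedges each containing both. For such a cycle $C$, $E(C)=\{h_0,\dots,h_{\ell-1}\}$. A Berge cycle is Hamiltonian if it contains every vertex of the hypergraph. An $n$-vertex hypergraph is Berge-pancyclic if it contains Berge cycles of every length $2,3,\dots,n$. The subhypergraph with a given edge set keeps the same vertex set. *)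

(* Defs.v *)
From mathcomp Require Import all_boot.

Set Implicit Arguments.
Unset Strict Implicit.
Unset Printing Implicit Defensive.

(* The vertex set is the finite type [V]; the edge family is a set of sets,
   which makes every hypergraph finite and simple. *)
Notation hypergraph V := {set {set V}} (only parsing).

Definition uniform (V : finType) (r : nat) (H : hypergraph V) : Prop :=
  forall e : {set V}, e \in H -> #|e| = r.

(* The cycle x_0 h_0 x_1 h_1 ... x_(l-1) h_(l-1) x_0; [ordS] is the successor
   modulo l. *)
Definition berge_cycle (V : finType) (H : hypergraph V) (l : nat)
    (x : 'I_l -> V) (h : 'I_l -> {set V}) : Prop :=
  [/\ 2 <= l,
      injective x,
      injective h,
      forall i, h i \in H
    & forall i, [set x i; x (ordS i)] \subset h i].

Definition cycle_edges (V : finType) (l : nat) (h : 'I_l -> {set V}) :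
    hypergraph V := [set h i | i : 'I_l].

Definition hamiltonian (V : finType) (l : nat) (x : 'I_l -> V) : Prop :=
  forall v : V, exists i : 'I_l, x i = v.

Definition berge_pancyclic (V : finType) (H : hypergraph V) : Prop :=
  forall l : nat, 2 <= l <= #|V| ->
    exists (x : 'I_l -> V) (h : 'I_l -> {set V}), berge_cycle H x h.

(* Main.v *)
(* Let the Hamiltonian cycle be y_0 e_0 y_1 e_1 ..., with indices modulo n, and
   suppose that there is no cycle of length d + 1, where 2 <= d <= n - 2.  A path
   of d edges closed up by f is excluded, so f and its translate by d are
   disjoint; as |f| is nearly n / 2, they leave at most two indices uncovered.
   Counting then gives 1 <= delta <= 3 and, after a rotation, y_0 and
   y_(d - delta) in f.  Cycles that use f and one chord of e_0 (resp. of e_d)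
   force every y_q in e_0 with d <= q <= n - delta (resp. in e_d with
   q <= d - delta) to yield an index z such that neither z nor z + d + delta - 1
   lies in f, and there are at most six such z.  Hence e_0 is almost contained in
   the arc [0, d - delta] and e_d in the complementary arc, both are nearly that
   large, and the cycle can be shortened along both arcs independently: by
   pigeonhole some pair of shortcuts y_q1 in e_0, y_(d + q2) in e_d satisfies
   q1 + q2 = n - d + 1, which gives a cycle of length d + 1. *)

Require Import Defs.
From mathcomp Require Import all_boot.
From mathcomp Require Import zify.
From Stdlib Require Import Classical_Prop.

Set Implicit Arguments.
Unset Strict Implicit.
Unset Printing Implicit Defensive.

(** * Unrolled Hamiltonian cycles *)

Definition has_cycle (V : finType) (H : {set {set V}}) (l : nat) : Prop :=
  exists (x : 'I_l -> V) (h : 'I_l -> {set V}), berge_cycle H x h.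

(* A Hamiltonian cycle unrolled along [nat], with period [n], so that it can be
   rotated freely, together with one further edge. *)
Record ham_frame (V : finType) (H : {set {set V}}) (n : nat) (f : {set V})
    (y : nat -> V) (e : nat -> {set V}) : Prop := HamFrame {
  frame_extra : f \in H;
  frame_edge k : e k \in H;
  frame_extraN k : e k != f;
  frame_vertex_eq i j : (y i == y j) = (i == j %[mod n]);
  frame_edge_eq i j : (e i == e j) = (i == j %[mod n]);
  frame_memL k : y k \in e k;
  frame_memR k : y k.+1 \in e k }.

Lemma frame_shift (V : finType) (H : {set {set V}}) n f y e c :
  @ham_frame V H n f y e -> ham_frame H n f (fun k => y (c + k)) (fun k => e (c + k)).
Proof.
case=> fH eH eN yE eE mL mR; split=> // [i j|i j|k].
- by rewrite yE eqn_modDl.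
- by rewrite eE eqn_modDl.
- by rewrite addnS.
Qed.

Lemma frame_vertexD (V : finType) (H : {set {set V}}) n f y e k :
  @ham_frame V H n f y e -> y (k + n) = y k.
Proof. by case=> _ _ _ yE _ _ _; apply/eqP; rewrite yE modnDr. Qed.

Lemma frame_edgeD (V : finType) (H : {set {set V}}) n f y e k :
  @ham_frame V H n f y e -> e (k + n) = e k.
Proof. by case=> _ _ _ _ eE _ _; apply/eqP; rewrite eE modnDr. Qed.

(* The edge index [n] stands for [f]. *)
Lemma cycle_of_indices (V : finType) (H : {set {set V}}) n f y e l
    (v w : nat -> nat) (E := fun m => if m == n then f else e m) :
  @ham_frame V H n f y e -> 2 <= l ->
  (forall t, t < l -> v t < n) -> (forall t, t < l -> w t <= n) ->
  (forall s t, s < t -> t < l -> v s != v t) ->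
  (forall s t, s < t -> t < l -> w s != w t) ->
  (forall t, t < l -> y (v t) \in E (w t)) ->
  (forall t, t.+1 < l -> y (v t.+1) \in E (w t)) ->
  y (v 0) \in E (w l.-1) ->
  has_cycle H l.
Proof.
move=> [fH eH eN yE eE _ _] l2 vn wn vI wI mL mR m0.
exists (fun i => y (v i)), (fun i => E (w i)); split=> //.
- move=> i j /eqP; rewrite yE !modn_small ?vn // => /eqP vij; apply/val_inj => /=.
  have [/vI|/vI|//] := ltngtP i j; last by move/(_ (ltn_ord i)); rewrite vij eqxx.
  by move/(_ (ltn_ord j)); rewrite vij eqxx.
- have EI s t : s <= n -> t <= n -> E s = E t -> s = t.
    rewrite /E; case: eqVneq => [->|sn] sle; case: eqVneq => [->|tn] tle // /eqP.
    + by rewrite eq_sym (negPf (eN _)).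
    + by rewrite (negPf (eN _)).
    + by rewrite eE !modn_small; [move/eqP| lia | lia].
  move=> i j /EI wij; apply/val_inj => /=.
  have {}wij := wij (wn _ (ltn_ord i)) (wn _ (ltn_ord j)).
  have [/wI|/wI|//] := ltngtP i j; last by move/(_ (ltn_ord i)); rewrite wij eqxx.
  by move/(_ (ltn_ord j)); rewrite wij eqxx.
- by move=> i; rewrite /E; case: ifP.
move=> i; apply/subsetP => u; rewrite !inE => /orP[] /eqP-> /=; first exact: mL.
have li := ltn_ord i.
have [il|il] := ltnP i.+1 l; first by rewrite modn_small // mR.
have -> : i.+1 = l by lia.
by rewrite modnn; have -> : nat_of_ord i = l.-1 by lia.
Qed.

(** * Explicit Berge cycles along a frame *)

Ltac lia_ifs :=
  intros; repeat match goal with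
  | |- context [if ?b then _ else _] => case: (boolP b)
  end; lia.

(** The cycle y_0 ... y_d -f- y_0. *)
Lemma cycle_with_extra (V : finType) (H : {set {set V}}) n f y e d :
  @ham_frame V H n f y e -> 0 < d < n -> y 0 \in f -> y d \in f ->
  has_cycle H d.+1.
Proof.
move=> fr dn f0 fd.
apply: (@cycle_of_indices V H n f y e d.+1 id (fun t => if t == d then n else t)) => //=;
  [by lia_ifs .. | | |].
- move=> t tl; case: (eqVneq t d) => [->|td]; first by rewrite eqxx.
  by rewrite ifN ?(frame_memL fr) //; lia.
- move=> t tl; case: (eqVneq t d) => td; first lia.
  by rewrite ifN ?(frame_memR fr) //; lia.
by rewrite !eqxx.
Qed.

(* The cycle y_0 ... y_a -f- y_b y_(b-1) ... y_p -e_(n-1)- y_0. *)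
Lemma cycle_chord_left (V : finType) (H : {set {set V}}) n f y e d a b p :
  @ham_frame V H n f y e -> 1 < d -> a < p <= b -> b < n -> a + b + 1 = p + d ->
  y a \in f -> y b \in f -> y p \in e n.-1 -> has_cycle H d.+1.
Proof.
move=> fr d1 apb bn abp fa fb hp.
(* The reflection of [t] to [a + b + 1 - t] walks the second arc downwards from [b]; the length
   hypothesis makes it reach [p] exactly at [t = d]. *)
apply: (@cycle_of_indices V H n f y e d.+1
  (fun t => if t <= a then t else a + b + 1 - t)
  (fun t => if t < a then t else if t == a then n else
            if t == d then n.-1 else a + b - t)) => //=;
  [by lia_ifs .. | | |].
- move=> t tl; case: (ltngtP t a) => [ta|ta|->]; last by rewrite eqxx.
    by rewrite ifN ?(frame_memL fr) //; lia.
  case: (eqVneq t d) => [->|td].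
    by rewrite ifN; [rewrite (_ : a + b + 1 - d = p) //; lia | lia].
  rewrite ifN; last lia.
  by rewrite (_ : a + b + 1 - t = (a + b - t).+1) ?(frame_memR fr) //; lia.
- move=> t tl; case: (ltngtP t a) => [ta|ta|->].
  + by rewrite ifN ?(frame_memR fr) //; lia.
  + rewrite (_ : t == d = false); last lia.
    rewrite ifN; last lia.
    by rewrite (_ : a + b + 1 - t.+1 = a + b - t) ?(frame_memL fr) //; lia.
  by rewrite eqxx (_ : a + b + 1 - a.+1 = b) //; lia.
rewrite ltnNge (_ : a <= d); last lia.
rewrite (_ : d == a = false) ?eqxx /=; last lia.
rewrite ifN; last lia.
by rewrite -(frame_vertexD 0 fr) add0n -[X in y X](@prednK n) ?(frame_memR fr) //; lia.
Qed.

(* The cycle y_a ... y_p -e_(n-1)- y_(n-1) y_(n-2) ... y_b -f- y_a. *)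
Lemma cycle_chord_right (V : finType) (H : {set {set V}}) n f y e d a b p :
  @ham_frame V H n f y e -> 1 < d -> a <= p < b -> b < n -> a + b + d = p + n ->
  y a \in f -> y b \in f -> y p \in e n.-1 -> has_cycle H d.+1.
Proof.
move=> fr d1 apb bn abp fa fb hp.
apply: (@cycle_of_indices V H n f y e d.+1
  (fun t => if t <= p - a then a + t else n + p - a - t)
  (fun t => if t < p - a then a + t else if t == p - a then n.-1 else
            if t == d then n else n + p - a - t.+1)) => //=;
  [by lia_ifs .. | | |].
- move=> t tl; case: (ltngtP t (p - a)) => [ta|ta|->].
  + by rewrite ifN ?(frame_memL fr) //; lia.
  + case: (eqVneq t d) => [->|td].
      by rewrite eqxx (_ : n + p - a - d = b) //; lia.
    rewrite ifN; last lia.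
    by rewrite (_ : n + p - a - t = (n + p - a - t.+1).+1) ?(frame_memR fr) //; lia.
  by rewrite ifN; [rewrite (_ : a + (p - a) = p) //; lia | lia].
- move=> t tl; case: (ltngtP t (p - a)) => [ta|ta|->].
  + by rewrite ifN ?addnS ?(frame_memR fr) //; lia.
  + rewrite (_ : t == d = false); last lia.
    by rewrite ifN ?(frame_memL fr) //; lia.
  rewrite ifN; last lia.
  by rewrite (_ : n + p - a - (p - a).+1 = n.-1) ?(frame_memL fr) //; lia.
rewrite ltnNge (_ : p - a <= d); last lia.
by rewrite (_ : d == p - a = false) ?addn0 ?eqxx //=; lia.
Qed.

(* The cycle y_0 -e_0- y_q1 ... y_d -e_d- y_(d+q2) ... y_(n-1) y_0. *)
Lemma cycle_two_jumps (V : finType) (H : {set {set V}}) n f y e d q1 q2 :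
  @ham_frame V H n f y e -> 1 < d < n -> 0 < q1 <= d -> 0 < q2 -> d + q2 < n ->
  q1 + q2 = n - d + 1 ->
  y q1 \in e 0 -> y (d + q2) \in e d -> has_cycle H d.+1.
Proof.
move=> fr dn q1d q20 dq2n q12 h1 h2.
(* The edge leaving each vertex carries that vertex's index, so [v] lists the edges as well. *)
pose v t := if t == 0 then 0 else if t <= d - q1 + 1 then q1 + t - 1
            else q1 + q2 + t - 2.
have vn t : t < d.+1 -> v t < n by rewrite /v; lia_ifs.
apply: (@cycle_of_indices V H n f y e d.+1 v v) => //=;
  [by lia_ifs | by move=> t /vn; lia | by rewrite /v; lia_ifs .. | | |].
- by move=> t /vn tn; rewrite ifN ?(frame_memL fr) //; lia.
- move=> t tl; rewrite ifN; last by have := vn t; lia.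
  case: (eqVneq t 0) => [->|t0]; first by rewrite /v /= addn1 addnK.
  case: (eqVneq t (d - q1 + 1)) => [->|t1].
    rewrite /v addn1 /= ltnn leqnn.
    by rewrite (_ : _ - 2 = d + q2) 1?(_ : _ - 1 = d) //; lia.
  rewrite (_ : v t.+1 = (v t).+1) ?(frame_memR fr) // /v.
  by lia_ifs.
rewrite ifN; last by have := vn d; lia.
rewrite (_ : v d = n.-1); last by rewrite /v; lia_ifs.
by rewrite -(frame_vertexD 0 fr) add0n -[X in y X](@prednK n) ?(frame_memR fr) //; lia.
Qed.

Lemma cycle_full (V : finType) (H : {set {set V}}) n f y e :
  @ham_frame V H n f y e -> 1 < n -> has_cycle H n.
Proof.
move=> fr n1.
apply: (@cycle_of_indices V H n f y e n id id) => //=;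
  [by lia_ifs .. | | |].
- by move=> t tl; rewrite ifN ?(frame_memL fr) //; lia.
- by move=> t tl; rewrite ifN ?(frame_memR fr) //; lia.
rewrite ifN; last lia.
by rewrite -(frame_vertexD 0 fr) add0n -[X in y X](@prednK n) ?(frame_memR fr) //; lia.
Qed.

(** * Counting in periodic sets of naturals *)

Definition periodic (n : nat) (P : pred nat) := forall k, P (k + n) = P k.

Lemma periodic_modn n P k : periodic n P -> P (k %% n) = P k.
Proof.
move=> Pn; rewrite [in RHS](divn_eq k n) addnC.
by elim: (k %/ n) => [|m IH]; rewrite ?mul0n ?addn0 // mulSn addnCA addnC Pn.
Qed.

Lemma periodic_count_shift n P c : periodic n P ->
  count (fun k => P (k + c)) (iota 0 n) = count P (iota 0 n).
Proof.
move=> Pn; elim: c => [|c <-]; first by apply: eq_count => k /=; rewrite addn0.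
have := congr1 (count (fun k => P (k + c))) (iotaD 0 n 1).
rewrite addn1 -[n.+1]add1n iotaD count_cat -[0 + 1]addn0 iotaDl count_map !count_cat /=.
rewrite (eq_count (a2 := fun k => P (k + c.+1))); last by move=> k /=; rewrite add1n addnS addSn.
by rewrite !addn0 !add0n addnC [n + c]addnC Pn => /eqP; rewrite eqn_add2r => /eqP.
Qed.

Lemma periodic_existsP n P : 0 < n -> periodic n P ->
  reflect (exists k, P k) (has P (iota 0 n)).
Proof.
move=> n0 Pn; apply: (iffP hasP) => [[k _ Pk]|[k Pk]]; first by exists k.
by exists (k %% n); rewrite ?periodic_modn // mem_iota add0n ltn_mod.
Qed.

Lemma count_neither (P Q : pred nat) s :
  count (fun k => ~~ P k && ~~ Q k) s + count P s + count Q s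
  = size s + count (fun k => P k && Q k) s.
Proof. by elim: s => //= k s; case: (P k); case: (Q k) => /=; lia. Qed.

(** If no [k] outside [P] had its successor in [P], then [P] would be closed under predecessors,
    hence by periodicity empty or everything. *)
Lemma periodic_grow n P : periodic n P -> 0 < count P (iota 0 n) < n ->
  count P (iota 0 n) < count (fun k => P k || P k.+1) (iota 0 n).
Proof.
move=> Pn /andP[P0 Pn1]; have n0 : 0 < n by lia.
have QE : count (fun k => P k || P k.+1) (iota 0 n)
    = count P (iota 0 n) + count (fun k => ~~ P k && P k.+1) (iota 0 n).
  by elim: (iota 0 n) => //= k s ->; case: (P k); case: (P k.+1) => /=; lia.
rewrite QE -[X in X < _]addn0 ltn_add2l -has_count.
apply/negPn/negP => /(periodic_existsP n0) H.
have down k : P k.+1 -> P k.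
  move=> Pk; apply/negPn/negP => nPk; apply: H; last by exists k; rewrite nPk.
  by move=> j; rewrite -addSn !Pn.
have down0 j k : P (k + j) -> P k.
  by elim: j => [|j IH]; rewrite ?addn0 // addnS => /down.
move: P0; rewrite -has_count => /hasP[k _ Pk].
have Pall j : P j.
  (* Descend to [j] from [k + j * n], which lies in [P] by periodicity. *)
  apply: (down0 (k + j * n.-1)); rewrite (_ : _ + _ = k + j * n); last by nia.
  by elim: j => [|j IH]; rewrite ?mul0n ?addn0 // mulSn [n + _]addnC addnA Pn.
by move: Pn1; rewrite (eq_count (a2 := predT)) ?count_predT ?size_iota ?ltnn // => j; rewrite Pall.
Qed.

(** Between such a [k] and [k + m] some run of [P] begins, and each beginning serves at most [m]
    values of [k]. *)
Lemma periodic_entries n P m : periodic n P ->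
  count (fun k => ~~ P k && P (k + m)) (iota 0 n)
  <= m * count (fun k => ~~ P k && P k.+1) (iota 0 n).
Proof.
move=> Pn; elim: m => [|m IH].
  by rewrite leqn0 (eq_count (a2 := pred0)) ?count_pred0 // => k /=; rewrite addn0 andNb.
rewrite mulSn; apply: leq_trans (leq_add (leqnn _) IH).
rewrite -(@periodic_count_shift n (fun k => ~~ P k && P k.+1) m); last first.
  by move=> k; rewrite -addSn !Pn.
elim: (iota 0 n) => //= k s; rewrite addnS.
by case: (P k); case: (P (k + m)); case: (P (k + m).+1) => /=; lia.
Qed.

Lemma periodic_entries_exits n P m : periodic n P ->
  count (fun k => P k && ~~ P (k + m)) (iota 0 n)
  = count (fun k => ~~ P k && P (k + m)) (iota 0 n).
Proof.
move=> Pn; have := periodic_count_shift m Pn.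
have -> : count P (iota 0 n) = count (fun k => P k && P (k + m)) (iota 0 n)
    + count (fun k => P k && ~~ P (k + m)) (iota 0 n).
  by elim: (iota 0 n) => //= k s ->; case: (P k); case: (P (k + m)) => /=; lia.
have -> : count (fun k => P (k + m)) (iota 0 n)
    = count (fun k => P k && P (k + m)) (iota 0 n)
    + count (fun k => ~~ P k && P (k + m)) (iota 0 n).
  by elim: (iota 0 n) => //= k s ->; case: (P k); case: (P (k + m)) => /=; lia.
by move/eqP; rewrite eqn_add2l => /eqP->.
Qed.

(** By inclusion-exclusion, the places missed by [P] and its translate number at most two plus the
    overlap. An overlap at [k] puts [k + m] outside [P], since [k + m] and [k + m + d] are not both
    in [P]; so it is an exit over [m] steps, and exits are as numerous as entries. *)
Lemma count_neither_shift n r P d m : periodic n P ->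
  count P (iota 0 n) = r -> n <= r.*2.+2 ->
  (forall k, P k -> ~~ P (k + d)) ->
  count (fun k => ~~ P k && ~~ P (k + (d + m))) (iota 0 n)
  <= 2 + m * count (fun k => ~~ P k && P k.+1) (iota 0 n).
Proof.
move=> Pn Pr nr Pd.
have := count_neither P (fun k => P (k + (d + m))) (iota 0 n).
rewrite (periodic_count_shift _ Pn) Pr size_iota.
have : count (fun k => P k && P (k + (d + m))) (iota 0 n)
    <= count (fun k => P k && ~~ P (k + m)) (iota 0 n).
  apply: sub_count => k /andP[-> Pk] /=; apply/negP => /Pd.
  by rewrite -addnA [m + d]addnC Pk.
by rewrite (periodic_entries_exits _ Pn); have := periodic_entries m Pn; lia.
Qed.

(* If [delta = 1] fails, the set is disjoint from two consecutive translates of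
   itself, so it consists of at most two runs; a fourth consecutive disjoint
   translate would not leave enough room. *)
Lemma near_translate n r P d : periodic n P ->
  count P (iota 0 n) = r -> n <= r.*2.+2 -> 8 <= r -> 1 < d -> d.+1 < n ->
  (forall k, P k -> ~~ P (k + d)) ->
  exists delta w, [/\ 0 < delta <= 3, delta < minn d (n - d), P w, P (w + (d - delta))
    & count (fun k => ~~ P k && ~~ P (k + (d + delta.-1))) (iota 0 n) <= 6].
Proof.
move=> Pn Pr nr r8 d1 dn Pd; have n0 : 0 < n by lia.
have Mle m := count_neither_shift m Pn Pr nr Pd.
have per m : periodic n (fun k => P k && P (k + (d - m))).
  by move=> k; rewrite addnAC !Pn.
have [/(periodic_existsP n0 (per 1))[w /andP[Pw Pw1]]|no1] :=
  boolP (has (fun k => P k && P (k + (d - 1))) (iota 0 n)).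
  by exists 1, w; split=> //; have := Mle 0; rewrite addn0 /=; lia.
have nP m : ~~ has (fun k => P k && P (k + (d - m))) (iota 0 n) ->
    forall k, P k -> ~~ P (k + (d - m)).
  move=> H k Pk; apply: contra H => Pk'; apply/(periodic_existsP n0 (per m)).
  by exists k; rewrite Pk.
have {}no1 := nP _ no1.
(* Now [P (k + d)] excludes both [P k] and [P k.+1]. Since [n - r <= r + 2], at most two runs of [P]
   begin in a period. *)
have c2 : count P (iota 0 n) + count (fun k => ~~ P k && P k.+1) (iota 0 n) <= n - r.
  have := count_predC (fun k => P (k + d)) (iota 0 n).
  rewrite (periodic_count_shift _ Pn) Pr size_iota.
  suff : count P (iota 0 n) + count (fun k => ~~ P k && P k.+1) (iota 0 n)
      <= count (predC (fun k => P (k + d))) (iota 0 n) by lia.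
  have PP k : P k.+1 -> ~~ P (k + d).
    by move=> /no1; rewrite addSnnS (_ : (d - 1).+1 = d) //; lia.
  elim: (iota 0 n) => //= k s; have := PP k; have := Pd k.
  by case: (P k); case: (P k.+1); case: (P (k + d)) => //= H1 H2;
    rewrite ?(H1 isT) ?(H2 isT); lia.
have Pd' k : P (k + (n - d)) -> ~~ P k.
  by apply: contraL => Pk; apply/negP => /Pd; rewrite -addnA subnK ?Pn ?Pk //; lia.
(* All [r] elements are entries over [d] steps and there are at most two runs, so [d], and likewise
   [n - d], is at least 4. This leaves room for [delta] up to 3. *)
have rd : r <= d * 2.
  have := periodic_entries d Pn.
  suff -> : count (fun k => ~~ P k && P (k + d)) (iota 0 n) = r by nia.
  rewrite -Pr -(periodic_count_shift d Pn); apply: eq_count => k /=.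
  by case Pk: (P k) => //=; rewrite (negPf (Pd _ Pk)).
have rd' : r <= (n - d) * 2.
  have := periodic_entries (n - d) Pn.
  suff -> : count (fun k => ~~ P k && P (k + (n - d))) (iota 0 n) = r by nia.
  rewrite -Pr -(periodic_count_shift (n - d) Pn); apply: eq_count => k /=.
  by case Pk: (P (k + (n - d))); rewrite ?andbF // Pd'.
have [/(periodic_existsP n0 (per 2))[w /andP[Pw Pw2]]|/nP no2] :=
  boolP (has (fun k => P k && P (k + (d - 2))) (iota 0 n)).
  by exists 2, w; split=> //; try lia; have := Mle 1; rewrite /=; lia.
have [/(periodic_existsP n0 (per 3))[w /andP[Pw Pw3]]|/nP no3] :=
  boolP (has (fun k => P k && P (k + (d - 3))) (iota 0 n)).
  by exists 3, w; split=> //; try lia; have := Mle 2; rewrite /=; lia.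
(* With [delta] = 1, 2, 3 all excluded, three successive enlargements of [P] by one step still avoid
   the translate by [d]. Each gains an element, so [r + 3 <= n - r <= r + 2]. *)
exfalso.
pose grow (Q : pred nat) k := Q k || Q k.+1.
have perg Q : periodic n Q -> periodic n (grow Q).
  by move=> Qn k; rewrite /grow -addSn !Qn.
have g3 : count (grow (grow (grow P))) (iota 0 n) <= n - r.
  have := count_predC (fun k => P (k + d)) (iota 0 n).
  rewrite (periodic_count_shift _ Pn) Pr size_iota.
  suff : count (grow (grow (grow P))) (iota 0 n)
      <= count (predC (fun k => P (k + d))) (iota 0 n) by lia.
  apply: sub_count => k /=.
  have P1 : P k.+1 -> ~~ P (k + d) by move=> /no1; rewrite (_ : _ + _ = k + d) //; lia.
  have P2 : P k.+2 -> ~~ P (k + d) by move=> /no2; rewrite (_ : _ + _ = k + d) //; lia.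
  have P3 : P k.+3 -> ~~ P (k + d) by move=> /no3; rewrite (_ : _ + _ = k + d) //; lia.
  by move=> /orP[/orP[/orP[/Pd|]|/orP[]]|/orP[/orP[]|/orP[]]].
have step Q : periodic n Q -> 0 < count Q (iota 0 n) ->
    count (grow Q) (iota 0 n) <= n - r -> count Q (iota 0 n) < count (grow Q) (iota 0 n).
  move=> Qn Q0 gQ; apply: periodic_grow => //; rewrite Q0 /=.
  apply: leq_ltn_trans (_ : n - r < n); last lia.
  by apply: leq_trans gQ; apply: sub_count => k /= Qk; rewrite /grow Qk.
have mono Q : count Q (iota 0 n) <= count (grow Q) (iota 0 n).
  by apply: sub_count => k /= Qk; rewrite /grow Qk.
have p1 := perg _ Pn; have p2 := perg _ p1.
have m0 := mono P; have m1 := mono (grow P); have m2 := mono (grow (grow P)).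
have s2 : count (grow (grow P)) (iota 0 n) < count (grow (grow (grow P))) (iota 0 n).
  by apply: step => //; lia.
have s1 : count (grow P) (iota 0 n) < count (grow (grow P)) (iota 0 n).
  by apply: step => //; lia.
have s0 : count P (iota 0 n) < count (grow P) (iota 0 n).
  by apply: step => //; lia.
lia.
Qed.

Lemma count_iota_le (P Q : pred nat) a b m n :
  (forall k, k < m -> P (a + k) -> Q (b + k)) -> b + m <= n ->
  count P (iota a m) <= count Q (iota 0 n).
Proof.
move=> PQ bmn; rewrite (_ : n = b + (m + (n - (b + m)))); last lia.
rewrite !iotaD !count_cat add0n.
suff : count P (iota a m) <= count Q (iota b m) by lia.
elim: m a b PQ {bmn} => //= m IH a b PQ; apply: leq_add.
  by have := PQ 0; rewrite !addn0; case: (P a) => // ->.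
by apply: IH => k km; rewrite !addSnnS; apply: PQ.
Qed.

Lemma count_iota_rev (P : pred nat) m :
  count (fun k => P (m - k.+1)) (iota 0 m) = count P (iota 0 m).
Proof.
elim: m => // m IH; rewrite -[in RHS]addn1 iotaD count_cat -IH /= subn1 addn0 addnC.
by rewrite (iotaDl 1 0) count_map.
Qed.

(** * Lengths from 3 to n - 1 *)

Lemma frame_periodic (V : finType) (H : {set {set V}}) n f y e (A : {set V}) :
  @ham_frame V H n f y e -> periodic n (fun k => y k \in A).
Proof. by move=> fr k; rewrite (frame_vertexD _ fr). Qed.

Lemma frame_count (V : finType) (H : {set {set V}}) n f y e (A : {set V}) :
  @ham_frame V H n f y e -> #|V| = n ->
  count (fun k => y k \in A) (iota 0 n) = #|A|.
Proof.
move=> fr Vn.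
have u : uniq (map y (iota 0 n)).
  rewrite map_inj_in_uniq ?iota_uniq // => i j.
  rewrite !mem_iota /= => iN jN /eqP.
  by rewrite (frame_vertex_eq fr) !modn_small // => /eqP.
have -> : count (fun k => y k \in A) (iota 0 n) = count (mem A) (map y (iota 0 n)).
  by rewrite count_map.
have yall : map y (iota 0 n) =i predT.
  apply/subset_cardP; last exact/subsetP.
  by rewrite (card_uniqP u) size_map size_iota cardT -cardE.
rewrite -size_filter -(card_uniqP (filter_uniq _ u)).
by apply: eq_card => v; rewrite mem_filter yall andbT.
Qed.

Lemma cycle_of_near_translate (V : finType) (H : {set {set V}}) n f y e d delta :
  @ham_frame V H n f y e -> #|V| = n -> 100 <= n ->
  (forall k, n <= #|e k|.*2.+2) ->
  0 < delta <= 3 -> delta < minn d (n - d) ->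
  y 0 \in f -> y (d - delta) \in f ->
  count (fun k => (y k \notin f) && (y (k + (d + delta.-1)) \notin f)) (iota 0 n) <= 6 ->
  has_cycle H d.+1.
Proof.
move=> fr Vn n100 er de dd f0 fd c6; apply: NNPP => noC.
have n0 : 0 < n by lia.
have d1 : 1 < d by lia.
(* The chord lemmas take their chord in the edge of index [n.-1]; rotating the frame by [c + 1] puts
   [e c] there. *)
have e0n c : e (c + 1 + n.-1) = e c.
  by rewrite -(frame_edgeD c fr) -addnA add1n prednK.
have y0n c : y (c + n) = y c by rewrite (frame_vertexD _ fr).
(* If [y (q - d + 1)] is in [f], then [f] joins it to [y 0] in a cycle; if [y (q + delta)] is in
   [f], then [f] joins it to [y (d - delta)]. *)
have far0 q : d <= q <= n - delta -> y q \in e 0 ->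
    (y (q - d + 1) \notin f) && (y (q - d + 1 + (d + delta.-1)) \notin f).
  move=> qd qe; apply/andP; split; apply/negP => Fq; apply: noC.
  - apply: (cycle_chord_right (a := q - d) (b := n.-1) (p := q.-1) (frame_shift 1 fr)) => //;
      try lia.
    + by rewrite addnC.
    + by rewrite add1n prednK // -(add0n n) y0n.
    + by rewrite -[1]add0n e0n add0n add1n prednK //; lia.
  - apply: (cycle_chord_left (a := d - delta - 1) (b := q + delta - 1) (p := q.-1)
      (frame_shift 1 fr)) => //; try lia.
    + by rewrite (_ : _ + _ = d - delta) //; lia.
    + by move: Fq; rewrite (_ : _ + _ = 1 + (q + delta - 1)) //; lia.
    + by rewrite -[1]add0n e0n add0n add1n prednK //; lia.
have fard q : q <= d - delta -> y q \in e d ->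
    (y (q + 1) \notin f) && (y (q + 1 + (d + delta.-1)) \notin f).
  move=> qd qe; apply/andP; split; apply/negP => Fq; apply: noC.
  - apply: (cycle_chord_right (a := n - d.+1) (b := q + n - d) (p := q + n - d.+1)
      (frame_shift (d + 1) fr)) => //; try lia.
    + by rewrite (_ : _ + _ = 0 + n) ?y0n //; lia.
    + by rewrite (_ : _ + _ = q + 1 + n) ?y0n //; lia.
    + by rewrite e0n (_ : _ + _ = q + n) ?y0n //; lia.
  - apply: (cycle_chord_left (a := q + delta.-1) (b := n - delta.+1) (p := q + n - d.+1)
      (frame_shift (d + 1) fr)) => //; try lia.
    + by move: Fq; rewrite (_ : q + _ + _ = d + 1 + (q + delta.-1)) //; lia.
    + by rewrite (_ : _ + _ = d - delta + n) ?y0n //; lia.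
    + by rewrite e0n (_ : _ + _ = q + n) ?y0n //; lia.
set Z := fun k => _ in c6.
(* Outside the arc from 1 to [d - delta], index 0 and two gaps of [delta.-1 <= 2] indices contribute
   at most 5, and the indices covered by [far0] at most 6. *)
have c1 : #|e 0| <= count (fun k => y k \in e 0) (iota 1 (d - delta)) + 11.
  rewrite -(frame_count (e 0) fr Vn).
  rewrite {1}(_ : n = 1 + (d - delta + (delta.-1 + ((n - delta - d).+1 + delta.-1)))); last lia.
  rewrite !iotaD !count_cat !add0n.
  set far := iota _ (n - delta - d).+1.
  have : count (fun k => y k \in e 0) far <= 6.
    apply: leq_trans c6; apply: (@count_iota_le _ _ _ 1) => [k km ke|]; last lia.
    have := far0 _ _ ke; rewrite (_ : _ - d + 1 = 1 + k); last lia.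
    by apply; lia.
  have S s : count (fun k => y k \in e 0) s <= size s by apply: count_size.
  have := S (iota 0 1); have := S (iota (1 + (d - delta)) delta.-1).
  have := S (iota (1 + (d - delta) + delta.-1 + (n - delta - d).+1) delta.-1).
  by rewrite !size_iota; lia.
have c2 : #|e d| <= count (fun k => y k \in e d) (iota d.+1 (n - delta - d)) + 11.
  rewrite -(frame_count (e d) fr Vn).
  rewrite {1}(_ : n = (d - delta).+1 + (delta.-1 + (1 + ((n - delta - d) + delta.-1)))); last lia.
  rewrite !iotaD !count_cat !add0n.
  rewrite (_ : (d - delta).+1 + delta.-1 + 1 = d.+1); last lia.
  have : count (fun k => y k \in e d) (iota 0 (d - delta).+1) <= 6.
    apply: leq_trans c6; apply: (@count_iota_le _ _ _ 1) => [k km ke|]; last lia.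
    by have := fard k _ ke; rewrite addn1 add1n; apply; lia.
  have S s : count (fun k => y k \in e d) s <= size s by apply: count_size.
  have := S (iota ((d - delta).+1 + delta.-1) 1); have := S (iota (d - delta).+1 delta.-1).
  have := S (iota (d.+1 + (n - delta - d)) delta.-1).
  by rewrite !size_iota; lia.
pose L := maxn d (n - d).
pose A k := (k < d - delta) && (y (1 + k) \in e 0).
pose B k := (k < n - d - delta) && (y (d.+1 + k) \in e d).
(* The second arc is reversed so that [A k] and [B' k] give [q1 = 1 + k] and [q2 = n - d - k], with
   the sum that [cycle_two_jumps] requires. *)
pose B' k := (k < n - d) && B (n - d - k.+1).
have cA : count (fun k => y k \in e 0) (iota 1 (d - delta)) <= count A (iota 0 L).
  by apply: (@count_iota_le _ _ _ 0) => [k km ke|]; rewrite /A ?add0n ?km //; lia.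
have cB : count (fun k => y k \in e d) (iota d.+1 (n - delta - d)) <= count B' (iota 0 L).
  apply: leq_trans (_ : count B (iota 0 (n - d)) <= _).
    apply: (@count_iota_le _ _ _ 0) => [k km ke|]; last lia.
    by rewrite /B add0n ke andbT; lia.
  rewrite -count_iota_rev; apply: (@count_iota_le _ _ _ 0) => [k km ke|]; last lia.
  by rewrite /B' !add0n km.
have AB k : ~~ (A k && B' k).
  apply/negP => /andP[/andP[kd ke] /andP[kn /andP[k2 ke2]]]; apply: noC.
  apply: (cycle_two_jumps (q1 := 1 + k) (q2 := n - d - k) fr) => //; try lia.
  by rewrite (_ : d + _ = d.+1 + (n - d - k.+1)) //; lia.
have := count_neither A B' (iota 0 L).
rewrite (eq_count (a1 := fun k => A k && B' k) (a2 := pred0)); last first.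
  by move=> k; apply/negbTE/AB.
rewrite count_pred0 size_iota.
(* Let s be the smaller of [#|e 0|] and [#|e d|]. Both [d] and [n - d] are at least s - 10, so [L]
   is at most s + 12, while disjointness of [A] and [B'] makes [L] at least 2s - 22. Hence s is at
   most 34, but [100 <= n] forces it to be at least 49. *)
have := er 0; have := er d.
have := count_size (fun k => y k \in e 0) (iota 1 (d - delta)).
have := count_size (fun k => y k \in e d) (iota d.+1 (n - delta - d)).
have LE : L = maxn d (n - d) by [].
by rewrite !size_iota; lia.
Qed.

Lemma cycle_middle (V : finType) (H : {set {set V}}) n f y e d :
  @ham_frame V H n f y e -> #|V| = n -> 100 <= n ->
  n <= #|f|.*2.+2 -> (forall k, n <= #|e k|.*2.+2) ->
  1 < d -> d.+1 < n -> has_cycle H d.+1.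
Proof.
move=> fr Vn n100 fn en d1 dn; apply: NNPP => noC.
have Pn := frame_periodic f fr.
have Pd k : y k \in f -> y (k + d) \notin f.
  move=> Pk; apply/negP => Pkd; apply: noC.
  by apply: (cycle_with_extra (frame_shift k fr)); rewrite ?addn0 //; lia.
have [|delta [w [de dd Pw Pwd c6]]] := near_translate Pn (frame_count f fr Vn) fn _ d1 dn Pd.
  by lia.
(* Rotating by [w] moves the two marked elements of [f] to indices 0 and [d - delta]; a count over a
   full period is unchanged. *)
apply/noC/(cycle_of_near_translate (frame_shift w fr) Vn n100 _ de dd); rewrite ?addn0 //.
pose Z k := (y k \notin f) && (y (k + (d + delta.-1)) \notin f).
apply: leq_trans c6; rewrite -(@periodic_count_shift n Z w).
  by apply/eq_leq/eq_count => k; rewrite /Z ![w + _]addnC addnAC.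
by move=> k; rewrite /Z addnAC !(frame_vertexD _ fr).
Qed.

(** * Length 2 and the theorem *)

(** Two edges of size just under half the vertices may be disjoint, but three that pairwise share at
    most one vertex would cover at least [3 * r - 3] vertices. *)
Lemma three_sets_meet (V : finType) (A B C : {set V}) r :
  #|A| = r -> #|B| = r -> #|C| = r -> #|V| + 3 < 3 * r ->
  [|| 1 < #|A :&: B|, 1 < #|A :&: C| | 1 < #|B :&: C|].
Proof.
move=> Ar Br Cr Vr; apply/negPn/negP; rewrite !negb_or -!leqNgt => /and3P[AB AC BC].
have := cardsUI A B; have := cardsUI (A :|: B) C.
have : #|(A :|: B) :&: C| <= #|A :&: C| + #|B :&: C|.
  by rewrite setIUl; have := cardsUI (A :&: C) (B :&: C); lia.
have : #|A :|: B :|: C| <= #|V| by apply: max_card.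
by lia.
Qed.

Lemma cycle_two (V : finType) (H : {set {set V}}) (A B : {set V}) :
  A \in H -> B \in H -> A != B -> 1 < #|A :&: B| -> has_cycle H 2.
Proof.
move=> AH BH AB /card_gt1P[u [v [/setIP[uA uB] /setIP[vA vB] uv]]].
exists (fun i : 'I_2 => if i == ord0 then u else v).
exists (fun i : 'I_2 => if i == ord0 then A else B).
split=> //.
- move=> [[|[|//]] i2] [[|[|//]] j2] /= E; apply/val_inj => //=.
    by rewrite E eqxx in uv.
  by rewrite E eqxx in uv.
- move=> [[|[|//]] i2] [[|[|//]] j2] /= E; apply/val_inj => //=.
    by rewrite E eqxx in AB.
  by rewrite E eqxx in AB.
- by move=> i; case: ifP.
by move=> [[|[|//]] i2]; apply/subsetP => w; rewrite !inE => /orP[] /eqP->.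
Qed.

Theorem theorem1p2 :
  exists n0 : nat, forall n : nat, n0 <= n ->
  forall (V : finType) (H : {set {set V}}),
    #|V| = n ->
    uniform ((n - 1) %/ 2) H ->
  forall (l : nat) (x : 'I_l -> V) (h : 'I_l -> {set V}),
    berge_cycle H x h ->
    hamiltonian x ->
  forall f : {set V},
    f \in H :\: cycle_edges h ->
    berge_pancyclic (cycle_edges h :|: [set f]).
Proof.
exists 100 => n n100 V H Vn Hr l x h [_ xI hI hH xh] xham f /setDP[fH fh] m.
have ln : l = n.
  rewrite -Vn -[l]card_ord -(card_codom xI); apply: eq_card => v.
  by rewrite inE; have [i <-] := xham v; rewrite codom_f.
rewrite {l}ln in x h xI hI hH xh xham fh *.
have n0 : 0 < n by lia.
(* Reducing indices modulo [n] unrolls the given cycle into a frame. *)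
pose o k : 'I_n := Ordinal (ltn_pmod k n0).
set G := cycle_edges h :|: [set f].
have oE i j : (o i == o j) = (i == j %[mod n]) by [].
have oS k : o k.+1 = ordS (o k).
  by apply/val_inj; rewrite /= -[(k %% n).+1]addn1 modnDml addn1.
have hG k : h (o k) \in cycle_edges h by apply: imset_f.
have fr : ham_frame G n f (fun k => x (o k)) (fun k => h (o k)).
  split=> [|k|k|i j|i j|k|k].
  - by rewrite !inE eqxx orbT.
  - by rewrite inE hG.
  - by apply: contraNneq fh => <-.
  - by rewrite (inj_eq xI).
  - by rewrite (inj_eq hI).
  - by have /subsetP := xh (o k); apply; rewrite !inE eqxx.
  - by have /subsetP := xh (o k); apply; rewrite oS !inE eqxx orbT.
have hr k : #|h (o k)| = (n - 1) %/ 2 by apply: Hr.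
have fr' : #|f| = (n - 1) %/ 2 by apply: Hr.
have fn : n <= #|f|.*2.+2 by lia.
have hn k : n <= #|h (o k)|.*2.+2 by rewrite hr; lia.
rewrite Vn => mn.
have [m2|m2] := leqP m 2.
  have -> : m = 2 by lia.
  have hN i j : i < j < n -> h (o i) != h (o j).
    by move=> ij; rewrite (inj_eq hI) oE !modn_small; lia.
  have Vr : #|V| + 3 < 3 * ((n - 1) %/ 2) by lia.
  case/or3P: (three_sets_meet (hr 0) (hr 1) (hr 2) Vr);
    by apply: cycle_two; rewrite ?(frame_edge fr) ?hN //; lia.
have [->|mN] := eqVneq m n; first by apply: cycle_full fr _; lia.
rewrite -(@prednK m); last lia.
by apply: (cycle_middle fr) => //; lia.
Qed.
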